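(* Let $t\geq 2$ be a fixed even number. Then for all sufficiently large $n$ (i.e. there is $N\ge 2$ depending on $t$ such that for all $n\geq N$) the following holds: if $R=R_1\times\cdots\times R_n$, where every $R_i$ is an Artinian local ring with exactly $t$ proper ideals, then $\mathcal{EG}(R)$ is Class $1$.
   Context: All rings are commutative with identity. Proper ideals of a ring are the ideals different from the whole ring; the zero ideal is counted as a proper ideal (so a local ring with exactly $t$ proper ideals has $t+1$ ideals in total). $A(R)$ is the set of ideals of $R$ with non-zero annihilator, and $A(R)^*=A(R)\setminus\{(0)\}$. A non-zero ideal $I$ of $R$ is essential, written $I\leq_e R$, if it has non-zero intersection with every non-zero ideal of $R$. The essential annihilating-ideal graph $\mathcal{EG}(R)$ is the simple graph with vertex set $A(R)^*$ in which two distinct vertices $I,J$ are adjacent if and only if $\mathrm{Ann}(IJ)\leq_e R$. For a graph $G$, $\Delta(G)$ is the maximum degree and $\chi'(G)$ the edge chromatic number (smallest number of colors in an edge coloring in which adjacent edges get different colors). $G$ is Class $1$ if $\chi'(G)=\Delta(G)$. *)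

(* Defs.v *)
From HB Require Import structures.
From mathcomp Require Import all_boot all_algebra.
From mathcomp Require Import boolp classical_sets functions cardinality.

Set Implicit Arguments.
Unset Strict Implicit.
Unset Printing Implicit Defensive.

Import GRing.Theory.

Local Open Scope classical_set_scope.
Local Open Scope ring_scope.

(* The commutative rings below are comPzRingTypes, so that the zero ring is
   allowed; it is excluded by [local_ring]. *)

Section ProductRing.
Variables (I : Type) (R : I -> comPzRingType).

Definition product_ring : Type := forall i, R i.

HB.instance Definition _ := gen_eqMixin product_ring.
HB.instance Definition _ := gen_choiceMixin product_ring.

Implicit Types f g h : product_ring.

Definition pr_zero : product_ring := fun=> 0.
Definition pr_one : product_ring := fun=> 1.
Definition pr_opp f : product_ring := fun i => - f i.
Definition pr_add f g : product_ring := fun i => f i + g i.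
Definition pr_mul f g : product_ring := fun i => f i * g i.

Fact pr_addA : associative pr_add.
Proof. by move=> f g h; apply: functional_extensionality_dep => i; apply: addrA. Qed.
Fact pr_addC : commutative pr_add.
Proof. by move=> f g; apply: functional_extensionality_dep => i; apply: addrC. Qed.
Fact pr_add0 : left_id pr_zero pr_add.
Proof. by move=> f; apply: functional_extensionality_dep => i; apply: add0r. Qed.
Fact pr_addN : left_inverse pr_zero pr_opp pr_add.
Proof. by move=> f; apply: functional_extensionality_dep => i; apply: addNr. Qed.
Fact pr_mulA : associative pr_mul.
Proof. by move=> f g h; apply: functional_extensionality_dep => i; apply: mulrA. Qed.
Fact pr_mulC : commutative pr_mul.
Proof. by move=> f g; apply: functional_extensionality_dep => i; apply: mulrC. Qed.
Fact pr_mul1 : left_id pr_one pr_mul.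
Proof. by move=> f; apply: functional_extensionality_dep => i; apply: mul1r. Qed.
Fact pr_mulr1 : right_id pr_one pr_mul.
Proof. by move=> f; rewrite pr_mulC pr_mul1. Qed.
Fact pr_mulD : left_distributive pr_mul pr_add.
Proof. by move=> f g h; apply: functional_extensionality_dep => i; apply: mulrDl. Qed.
Fact pr_mulDr : right_distributive pr_mul pr_add.
Proof. by move=> f g h; rewrite pr_mulC pr_mulD !(pr_mulC f). Qed.

HB.instance Definition _ :=
  GRing.isZmodule.Build product_ring pr_addA pr_addC pr_add0 pr_addN.
HB.instance Definition _ :=
  GRing.Zmodule_isPzRing.Build product_ring
    pr_mulA pr_mul1 pr_mulr1 pr_mulD pr_mulDr.
HB.instance Definition _ :=
  GRing.PzRing_hasCommutativeMul.Build product_ring pr_mulC.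

End ProductRing.

Section Ideals.
Variable R : comPzRingType.
Implicit Types I J M : set R.

Definition is_ideal I :=
  [/\ I 0, (forall x y, I x -> I y -> I (x + y)) & (forall a x, I x -> I (a * x))].

Definition proper_ideals : set (set R) := [set I | is_ideal I /\ I <> setT].

Definition maximal_ideal M :=
  proper_ideals M /\ forall J, proper_ideals J -> M `<=` J -> J = M.

Definition local_ring := exists! M, maximal_ideal M.

Definition artinian_ring :=
  forall I_ : nat -> set R,
    (forall k, is_ideal (I_ k)) -> (forall k, I_ k.+1 `<=` I_ k) ->
    exists m, forall k, (m <= k)%N -> I_ k = I_ m.

Definition ideal_mul I J : set R :=
  smallest is_ideal [set x * y | x in I & y in J].

Definition Ann I : set R := [set r | forall x, I x -> r * x = 0].

Definition essential I :=
  [/\ is_ideal I, I <> [set 0] &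
      forall J, is_ideal J -> J <> [set 0] -> I `&` J <> [set 0]].

Definition annihilating_ideals : set (set R) :=
  [set I | is_ideal I /\ Ann I <> [set 0]].

Lemma ideal_mulC I J : ideal_mul I J = ideal_mul J I.
Proof.
suff H (A B : set R) : [set x * y | x in A & y in B] `<=`
    [set x * y | x in B & y in A].
  by rewrite /ideal_mul; congr (smallest _ _); apply/seteqP; split; apply: H.
by move=> _ [x Ax [y By <-]]; exists y => //; exists x; rewrite // mulrC.
Qed.

End Ideals.

Arguments proper_ideals : clear implicits.
Arguments annihilating_ideals : clear implicits.

Record sgraph (T : Type) := SGraph {
  vertices : set T;
  adj : T -> T -> Prop;
  adj_vertices : forall x y, adj x y -> vertices x /\ vertices y;
  adj_sym : forall x y, adj x y -> adj y x;
  adj_irrefl : forall x, ~ adj x x }.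

Section Graphs.
Variables (T : Type) (G : sgraph T).

Definition edges : set (set T) :=
  [set e | exists x y, adj G x y /\ e = [set x; y]].

Definition neighbors (x : T) : set T := [set y | adj G x y].

(* The graph may be infinite, so Delta(G) and chi'(G) are given as relations:
   [class1] asserts that both exist as natural numbers and coincide. *)
Definition is_max_degree (d : nat) :=
  (exists2 x, vertices G x & (neighbors x #= `I_d)%card) /\
  (forall x, vertices G x -> (neighbors x #<= `I_d)%card).

Definition edge_colorable (k : nat) :=
  exists c : set T -> nat,
    (forall e, edges e -> (c e < k)%N) /\
    (forall e f, edges e -> edges f -> e <> f -> e `&` f !=set0 -> c e <> c f).

Definition is_edge_chromatic_number (k : nat) :=
  edge_colorable k /\ forall j, edge_colorable j -> (k <= j)%N.

Definition class1 :=
  exists d, is_max_degree d /\ is_edge_chromatic_number d.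

End Graphs.

Section EssentialAnnihilatingIdealGraph.
Variable R : comPzRingType.

Definition EG_vertices : set (set R) :=
  annihilating_ideals R `\ [set 0].

Definition EG_adj (I J : set R) :=
  [/\ EG_vertices I, EG_vertices J, I <> J & essential (Ann (ideal_mul I J))].

Fact EG_adj_vertices I J : EG_adj I J -> EG_vertices I /\ EG_vertices J.
Proof. by case. Qed.

Fact EG_adj_sym I J : EG_adj I J -> EG_adj J I.
Proof. by case=> vI vJ IJ e; split=> //; [exact: nesym | rewrite ideal_mulC]. Qed.

Fact EG_adj_irrefl I : ~ EG_adj I I.
Proof. by case. Qed.

Definition EG : sgraph (set R) :=
  SGraph EG_adj_vertices EG_adj_sym EG_adj_irrefl.

End EssentialAnnihilatingIdealGraph.

(* Main.v *)
Require Import Defs.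
From HB Require Import structures.
From mathcomp Require Import all_boot all_algebra.
From mathcomp Require Import boolp classical_sets functions cardinality.
From mathcomp Require Import zify.

(* Every ideal of R is a product of ideals of the factors, and for a proper
   ideal K of a local Artinian ring Ann(K) is essential.  Hence two distinct
   vertices are adjacent iff in no coordinate both are the whole factor.  The
   graph has an odd number v = (t+1)^n - 2 of vertices, and the d = t^n - 1
   vertices without a full coordinate are adjacent to all others, so
   Delta = v - 1.

   Label the vertices by Z/v and colour the edge {a, b} by a + b.  To save the
   colour 0 one chooses the labels so that {a, -a} is an edge only if a or -a
   is dominating, the dominating labels being d+1, ..., 2d.  Such an edge
   {a, -a}, with a dominating, gets the colour 2a, which is unused at a; at -a
   it is the colour of {-a, 3a}, which is not an edge if the labels -a and 3a
   are given to ideals whose first coordinate is R_1.  There are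
   (t+1)^(n-1) - 1 ideals of this kind, more than 11 d for large n.  As t is
   even, the remaining vertices can be paired off by pairing the t proper ideals
   of R_1: paired vertices share a full coordinate, and they are labelled by
   opposite elements. *)

Set Implicit Arguments.
Unset Strict Implicit.
Unset Printing Implicit Defensive.

(** * Edge colouring by sums of labels modulo [v] *)

(* The colour 0 is replaced by twice the smaller label. *)
Definition sum_color (v a b : nat) : nat :=
  if (a + b) %% v == 0 then 2 * minn a b else (a + b) %% v.

Lemma modn_case (v s : nat) : s < 2 * v ->
  s %% v = if s < v then s else s - v.
Proof.
move=> h; case: ltnP => sv; first by rewrite modn_small.
by rewrite -[in LHS](subnK sv) modnDr modn_small //; lia.
Qed.

Lemma sum_colorC v a b : sum_color v a b = sum_color v b a.
Proof. by rewrite /sum_color addnC minnC. Qed.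

(** Distinct labels whose sum vanishes modulo [v] add up to [v] itself, so both are positive and
    twice the smaller one is below [v]. *)
Lemma sum_color_bound v a b : odd v -> a < v -> b < v -> a <> b ->
  0 < sum_color v a b < v.
Proof.
move=> ov av bv ab; rewrite /sum_color modn_case; last by lia.
by case: (ltnP (a + b) v) => h; case: eqP => h'; lia.
Qed.

(* [E] is adjacency of labels; [d+1, ..., 2d] are the dominating ones. *)
Lemma sum_color_proper (v d : nat) (E : rel nat) :
  odd v -> symmetric E -> 6 * d < v ->
  (forall a, 0 < a -> 2 * a < v -> ~~ (d < a <= 2 * d) -> ~~ E a (v - a)) ->
  (forall a, d < a <= 2 * d -> ~~ E (v - a) (3 * a)) ->
  forall a b c, a < v -> b < v -> c < v -> a <> b -> a <> c -> b <> c ->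
  E a b -> E a c -> sum_color v a b <> sum_color v a c.
Proof.
move=> ov symE dv H1 H2.
have key a b c : a < v -> b < v -> c < v -> a <> c -> b <> c ->
    a + b = v -> E a b -> E a c -> a + c <> v -> sum_color v a b <> sum_color v a c.
  move=> av bv cv ac bc abv Eab Eac acv.
  (* An edge between opposite labels contradicts [H1] unless the smaller label is dominating. *)
  have hm : d < minn a b <= 2 * d.
    apply/negP => /negP nm; move: Eab; apply/negP.
    have [lab|lab] := ltnP a b.
      have bE : b = v - a by lia.
      by rewrite bE; apply: H1 => //; lia.
    rewrite symE; have -> : a = v - b by lia.
    by apply: H1 => //; lia.
  rewrite /sum_color abv modnn /= modn_case; last by lia.
  (* At the smaller end a collision means 2a = a + c modulo [v], so c = a. At the larger end 2b = a
     + c with a = -b gives c = 3b, as 3b < v; this is excluded by [H2]. *)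
  have [lab|lab] := ltnP a b; first by case: (ltnP (a + c) v) => ?; case: eqP; lia.
  have hc : c <> 3 * b.
    move=> cE; have aE : a = v - b by lia.
    by move: Eac; apply/negP; rewrite cE aE; apply: H2; lia.
  by case: (ltnP (a + c) v) => ?; case: eqP; lia.
move=> a b c av bv cv ab ac bc Eab Eac.
have [abv|abv] := eqVneq (a + b) v; first by apply: key => //; lia.
have [acv|acv] := eqVneq (a + c) v.
  by apply/nesym; apply: (key a c b) => //; lia.
rewrite /sum_color !modn_case; try by lia.
case: (ltnP (a + b) v) => ?; case: (ltnP (a + c) v) => ?;
  by case: eqP => ?; case: eqP => ?; lia.
Qed.

(** * Colouring a graph whose vertices form a list *)

Section ListColoring.
Variables (T : eqType) (E : rel T).
Hypothesis symE : symmetric E.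
Hypothesis irrE : irreflexive E.

Definition proper_coloring (s : seq T) (k : nat) (c : T -> T -> nat) :=
  [/\ forall x y, c x y = c y x,
      forall x y, x \in s -> y \in s -> E x y -> c x y < k &
      forall x y z, x \in s -> y \in s -> z \in s -> y <> z ->
        E x y -> E x z -> c x y <> c x z].

(** Labels are positions in [s]. As [sum_color] avoids 0, taking predecessors leaves one colour
    fewer than there are vertices. *)
Lemma proper_coloring_labelled (x0 : T) (s : seq T) (d : nat) :
  uniq s -> odd (size s) -> 6 * d < size s ->
  (forall a, 0 < a -> 2 * a < size s -> ~~ (d < a <= 2 * d) ->
     ~~ E (nth x0 s a) (nth x0 s (size s - a))) ->
  (forall a, d < a <= 2 * d -> ~~ E (nth x0 s (size s - a)) (nth x0 s (3 * a))) ->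
  exists c, proper_coloring s (size s).-1 c.
Proof.
move=> us os ds H1 H2.
pose c x y := (sum_color (size s) (index x s) (index y s)).-1.
have neq x y : x \in s -> y \in s -> x <> y -> index x s <> index y s.
  by move=> xs ys xy /(congr1 (nth x0 s)); rewrite !nth_index.
have Eneq x y : E x y -> x <> y by move=> + xy; rewrite xy irrE.
have bnd x y : x \in s -> y \in s -> E x y ->
    0 < sum_color (size s) (index x s) (index y s) < size s.
  move=> xs ys /Eneq xy.
  by apply: sum_color_bound; rewrite ?index_mem //; apply: neq.
exists c; split.
- by move=> x y; rewrite /c sum_colorC.
- by move=> x y xs ys /(bnd _ _ xs ys); rewrite /c; lia.
- move=> x y z xs ys zs yz Exy Exz.
  have := bnd _ _ xs ys Exy; have := bnd _ _ xs zs Exz.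
  have := @sum_color_proper (size s) d (fun a b => E (nth x0 s a) (nth x0 s b))
    os (fun a b => symE _ _) ds H1 H2 (index x s) (index y s) (index z s).
  rewrite !index_mem !nth_index // => /(_ xs ys zs) h b1 b2.
  have {}h : sum_color (size s) (index x s) (index y s) <>
            sum_color (size s) (index x s) (index z s).
    by apply: h => //; apply: neq => //; apply: Eneq.
  by rewrite /c; lia.
Qed.

(* [D] consists of the dominating vertices.  The labels 0, 1, ... go to
   [z :: F], and -1, -2, ... to [S]; the parts [h1a], [h1b], [h2a], [h2b], [u]
   and [z] make up [A]. *)
Lemma proper_coloring_paired (A D r1 r2 : seq T) :
  uniq (A ++ D ++ r1 ++ r2) -> {in A &, forall x y, ~~ E x y} ->
  size r1 = size r2 -> (forall x0 i, i < size r1 -> ~~ E (nth x0 r1 i) (nth x0 r2 i)) ->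
  11 * size D < size A -> odd (size D) -> ~~ odd (size A) ->
  exists c, proper_coloring (A ++ D ++ r1 ++ r2) (size (A ++ D ++ r1 ++ r2)).-1 c.
Proof.
case: A => [|z B]; first by rewrite ltn0.
set d := size D => us indA sr hr dA oD oA.
(* Both [size B] and [d] are odd, so [B] without its first [d] elements splits into two halves of
   size [k]. *)
pose k := (size B - d)./2.
have sB : size B = d + 2 * k by rewrite /k /= in oA dA *; lia.
(* This bound gives 3a - 1 < d + k for every dominating label a <= 2d. *)
have kd : 5 * d <= k by rewrite /k /= in oA dA *; lia.
pose u := take d B; pose h1 := take k (drop d B); pose h2 := drop k (drop d B).
have eB : B = u ++ (take d h1 ++ drop d h1) ++ (take d h2 ++ drop d h2).
  by rewrite !cat_take_drop.
have su : size u = d by rewrite size_takel //; lia.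
have sh1 : size h1 = k by rewrite size_takel // size_drop; lia.
have sh2 : size h2 = k by rewrite !size_drop; lia.
have [s1a s1b] : size (take d h1) = d /\ size (drop d h1) = k - d.
  by split; [rewrite size_takel; lia|rewrite size_drop; lia].
have [s2a s2b] : size (take d h2) = d /\ size (drop d h2) = k - d.
  by split; [rewrite size_takel; lia|rewrite size_drop; lia].
move: (take d h1) (drop d h1) (take d h2) (drop d h2) eB s1a s1b s2a s2b.
move=> h1a h1b h2a h2b eB s1a s1b s2a s2b.
(* The labels d+1, ..., 2d fall on [D]. The other labels from 1 to d+k, and the opposites of all of
   1, ..., d+k, fall on [A]. Beyond d+k, [r1] and [r2] face each other. *)
pose F := h1a ++ D ++ h1b ++ r1; pose S := h2a ++ u ++ h2b ++ r2.
pose s := z :: F ++ rev S.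
pose m := d + k + size r1.
have sF : size F = m by rewrite !size_cat -/d; lia.
have sS : size S = m by rewrite !size_cat; lia.
have ps : perm_eq s ((z :: B) ++ D ++ r1 ++ r2).
  by rewrite eB; apply/permP => p; rewrite /= !(count_cat, count_rev); lia.
have ss : size s = 2 * m + 1 by rewrite /= size_cat size_rev; lia.
(* The head [z] has label 0, which shifts the positions in [F] by one. *)
have nF a : 0 < a -> a <= m -> nth z s a = nth z F a.-1.
  by case: a => // a _ am; rewrite /= nth_cat sF am.
have nS a : 0 < a -> a <= m -> nth z s (size s - a) = nth z S a.-1.
  move=> a0 am; rewrite ss.
  have -> : 2 * m + 1 - a = (m + (m - a)).+1 by lia.
  rewrite /= nth_cat sF ltnNge leq_addr /= addKn nth_rev; last by lia.
  by rewrite sS; congr nth; lia.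
have memA x : x \in h1a ++ h1b ++ h2a ++ u ++ h2b -> x \in z :: B.
  by rewrite eB inE !mem_cat => /or4P[||| /orP[]] ->; rewrite ?orbT.
have memF i : i < d -> nth z F i \in z :: B.
  by move=> h; rewrite /F nth_cat s1a h memA // !mem_cat mem_nth ?s1a.
have memF' i : 2 * d <= i -> i < d + k -> nth z F i \in z :: B.
  move=> h h'; rewrite /F !nth_cat s1a s1b -/d ifF; last by lia.
  rewrite ifF; last by lia.
  by rewrite ifT ?memA // ?mem_cat ?mem_nth ?orbT ?s1b //; lia.
have memS i : i < d + k -> nth z S i \in z :: B.
  move=> h; rewrite /S !nth_cat s2a su s2b.
  case: ltnP => h1'; first by rewrite memA // !mem_cat mem_nth ?orbT ?s2a.
  case: ltnP => h2'; first by rewrite memA // !mem_cat (@mem_nth _ z u) ?orbT ?su.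
  by rewrite ifT ?memA // ?mem_cat ?mem_nth ?orbT ?s2b //; lia.
have [||||| c [c1 c2 c3]] := @proper_coloring_labelled z s d.
- by rewrite (perm_uniq ps).
- by rewrite ss; lia.
- by rewrite ss; lia.
- move=> a a0 am nd; rewrite nF ?nS //; try lia.
  have [ak|ak] := leqP a (d + k).
    apply: indA; last by apply: memS; lia.
    by have [ad|ad] := leqP a d; [apply: memF|apply: memF']; lia.
  rewrite /F /S !nth_cat s1a s2a su -/d s1b s2b !ifF; try lia.
  by apply: hr; lia.
(* Position 3a - 1 of [F] lies in [h1b], so both ends are in the independent set [A]. *)
- move=> a ad; rewrite nS ?nF; try lia.
  by apply: indA; [apply: memS|apply: memF']; lia.
rewrite -(perm_size ps); exists c; split => //.
- by move=> x y; rewrite -!(perm_mem ps); apply: c2.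
- by move=> x y w; rewrite -!(perm_mem ps); apply: c3.
Qed.
End ListColoring.

(** * Ideals of the product as words *)

(* The letter [ord_max] stands for the whole factor, the other letters for its
   proper ideals. *)
Section Words.
Variables n t : nat.
Local Notation word := {ffun 'I_n.+1 -> 'I_t.+1}.
Implicit Types f g z : word.

Definition word_adj : rel word :=
  fun f g => (f != g) && [forall i, ~~ ((f i == ord_max) && (g i == ord_max))].

Lemma word_adj_sym : symmetric word_adj.
Proof. by move=> f g; rewrite /word_adj eq_sym; under eq_forallb do rewrite andbC. Qed.

Lemma word_adj_irr : irreflexive word_adj.
Proof. by move=> f; rewrite /word_adj eqxx. Qed.

Lemma word_adjN f g i : f i = ord_max -> g i = ord_max -> ~~ word_adj f g.
Proof.
move=> fi gi; rewrite /word_adj negb_and; apply/orP; right.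
by apply/forallPn; exists i; rewrite fi gi eqxx.
Qed.

(** Here [z] is meant to be the word of the zero ideal; a proper coordinate is what gives an ideal a
    non-zero annihilator. *)
Definition word_vertex z : pred word :=
  [pred f | (f != z) && [exists i, f i != ord_max]].

Lemma card_words_max0 : #|[pred f : word | f ord0 == ord_max]| = t.+1 ^ n.
Proof.
pose F (i : 'I_n.+1) : pred 'I_t.+1 :=
  if i == ord0 then pred1 ord_max else predT.
have -> : #|[pred f : word | f ord0 == ord_max]| = #|(family F : simpl_pred word)|.
  apply: eq_card => f; rewrite !inE; apply/eqP/familyP => [f0 i|/(_ ord0)].
    by rewrite /F; case: eqP => // ->; rewrite inE f0.
  by rewrite /F eqxx => /eqP.
rewrite card_family foldrE big_map big_enum /= big_ord_recl /F eqxx card1 mul1n.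
under eq_bigr => i _ do rewrite eq_sym eq_liftF.
by rewrite prod_nat_const !card_ord.
Qed.

Lemma card_words_free : #|[pred f : word | [forall i, f i != ord_max]]| = t ^ n.+1.
Proof.
have -> : #|[pred f : word | [forall i, f i != ord_max]]| =
    #|(ffun_on (predC1 (ord_max : 'I_t.+1)) : simpl_pred word)|.
  by apply: eq_card => f; rewrite [LHS]inE; apply/forallP/ffun_onP => h i; have := h i.
by rewrite card_ffun_on cardC1 !card_ord.
Qed.

(** This exchanges 2j and 2j + 1 and fixes t; for even t it pairs off the letters of the proper
    ideals. *)
Definition swap_letter (a : 'I_t.+1) : 'I_t.+1 :=
  inord (if a == t :> nat then t else if odd a then a.-1 else a.+1).

Lemma val_swap_letter a : ~~ odd t ->
  swap_letter a = (if a == t :> nat then t else if odd a then a.-1 else a.+1) :> nat.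
Proof.
move=> et; rewrite inordK //; have := ltn_ord a.
by case: (eqVneq (a : nat) t) => ?; case: (boolP (odd a)) => ?; lia.
Qed.

Lemma swap_letterK : ~~ odd t -> involutive swap_letter.
Proof.
move=> et a; apply: ord_inj; rewrite !val_swap_letter //; have := ltn_ord a.
case: (eqVneq (a : nat) t) => [->|at_]; first by rewrite ?eqxx.
case: (boolP (odd a)) => oa ha.
  have -> : (a.-1 == t) = false by apply/eqP; lia.
  by have -> : odd a.-1 = false; lia.
have -> : (a.+1 == t) = false by apply/eqP; lia.
by rewrite /= oa.
Qed.

Definition swap_word f : word := [ffun i => if i == ord0 then swap_letter (f i) else f i].

Lemma swap_wordK : ~~ odd t -> involutive swap_word.
Proof.
by move=> et f; apply/ffunP => i; rewrite !ffunE; case: eqP => // _; rewrite swap_letterK.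
Qed.

(** Only the first coordinate is changed, and the full coordinate of [f] is a different one, so both
    words share it. *)
Lemma swap_word_nadj f : f ord0 != ord_max -> [exists i, f i == ord_max] ->
  ~~ word_adj f (swap_word f).
Proof.
move=> f0 /existsP[i /eqP fi]; apply: (@word_adjN _ _ i) => //; rewrite ffunE.
by case: eqP => // i0; rewrite -i0 fi eqxx in f0.
Qed.

(** The vertices split into [A] (first coordinate full), [D] (no full coordinate, hence dominating),
    and the rest, divided into [r1] and [r2] by the parity of the first letter. For even t the sizes
    (t+1)^n - 1 of [A] and t^(n+1) - 1 of [D] are even and odd, as the pairing requires. *)
Lemma word_coloring z : 2 <= t -> ~~ odd t -> (forall i, z i != ord_max) ->
  11 * t ^ n.+1 < t.+1 ^ n ->
  exists c, proper_coloring word_adj (enum (word_vertex z)) #|word_vertex z|.-1 c.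
Proof.
move=> t2 et zfree tn.
pose full : word := [ffun=> ord_max].
pose A := enum [pred f : word | (f ord0 == ord_max) && (f != full)].
pose D := enum [pred f : word | [forall i, f i != ord_max] && (f != z)].
pose r1 := enum [pred f : word | [&& ~~ odd (f ord0), f ord0 != ord_max
                                  & [exists i, f i == ord_max]]].
pose r2 := map swap_word r1.
have mA f : (f \in A) = (f ord0 == ord_max) && (f != full) by rewrite mem_enum.
have mD f : (f \in D) = [forall i, f i != ord_max] && (f != z) by rewrite mem_enum.
have m1 f : (f \in r1) = [&& ~~ odd (f ord0), f ord0 != ord_max
                                  & [exists i, f i == ord_max]] by rewrite mem_enum.
(* As [swap_word] is an involution, [f] is in [r2] iff its swap is in [r1]; below t, swapping flips
   the parity of the first letter and preserves the full coordinates. *)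
have m2 f : (f \in r2) = [&& odd (f ord0), f ord0 != ord_max
                                  & [exists i, f i == ord_max]].
  rewrite -[f in LHS](swap_wordK et) mem_map ?m1; last exact: inv_inj (swap_wordK et).
  rewrite ffunE eqxx -!val_eqE /= val_swap_letter //.
  have f0 := ltn_ord (f ord0).
  case: (eqVneq (f ord0 : nat) t) => [f0t|f0t] /=; first by rewrite eqxx !andbF.
  have -> : [exists i, swap_word f i == ord_max] = [exists i, f i == ord_max].
    apply: eq_existsb => i; rewrite ffunE; case: (i =P ord0) => // ->.
    rewrite -!val_eqE /= val_swap_letter // (negPf f0t).
    by case: ifP => of0; apply/eqP; lia.
  move: [exists i, f i == ord_max] => ex.
  by case: ifP => of0; case: eqP => ?; case: ex; lia.
have neD f : [exists i, f i == ord_max] = ~~ [forall i, f i != ord_max].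
  by rewrite negb_forall; apply: eq_existsb => i; rewrite negbK.
have U : uniq (A ++ D ++ r1 ++ r2).
  rewrite !cat_uniq !has_cat !enum_uniq (map_inj_uniq (inv_inj (swap_wordK et))).
  rewrite enum_uniq !negb_or /= !andbT.
  apply/and3P; split; [apply/and3P; split|apply/andP; split|]; apply/hasPn => f.
  - rewrite mD mA => /andP[/forallP/(_ ord0)/negPf ->] //.
  - by rewrite m1 mA => /and3P[_ /negPf ->].
  - by rewrite m2 mA => /and3P[_ /negPf ->].
  - by rewrite m1 mD neD => /and3P[_ _ /negPf ->].
  - by rewrite m2 mD neD => /and3P[_ _ /negPf ->].
  - by rewrite m2 m1 => /and3P[->].
have perm : perm_eq (A ++ D ++ r1 ++ r2) (enum (word_vertex z)).
  apply: uniq_perm => // [|f]; first exact: enum_uniq.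
  rewrite !mem_cat mA mD m1 m2 mem_enum inE neD.
  have -> : [exists i, f i != ord_max] = (f != full).
    apply/existsP/idP => [[i fi]|/eqP fn].
      by apply/eqP => fE; rewrite fE ffunE eqxx in fi.
    apply: contrapT => nf; apply: fn; apply/ffunP => i; rewrite ffunE.
    by apply/eqP/negPn/negP => fi; apply: nf; exists i.
  have [f0|f0] := eqVneq (f ord0) ord_max.
    have -> : [forall i, f i != ord_max] = false.
      by apply/forallP => /(_ ord0); rewrite f0 eqxx.
    rewrite !andbF !orbF /=; have -> // : f != z.
    by apply/eqP => fz; have := zfree ord0; rewrite -fz f0 eqxx.
  have -> : f != full by apply/eqP => ff; rewrite ff ffunE eqxx in f0.
  case: (boolP [forall i, _]) => fA /=; rewrite ?andbF ?orbF ?andbT //.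
  rewrite orbC orbN; symmetry.
  by apply/eqP => fz; case/negP: fA; apply/forallP; rewrite fz.
have sA : (size A).+1 = t.+1 ^ n.
  rewrite -card_words_max0 (cardD1 full) inE ffunE eqxx add1n -cardE.
  by congr _.+1; apply: eq_card => f; rewrite !inE andbC.
have sD : (size D).+1 = t ^ n.+1.
  rewrite -card_words_free (cardD1 z) inE (introT forallP zfree) add1n -cardE.
  by congr _.+1; apply: eq_card => f; rewrite !inE andbC.
have [|||||| c [c1 c2 c3]] :=
  @proper_coloring_paired _ _ word_adj_sym word_adj_irr A D r1 r2 U.
- move=> f g; rewrite !mA => /andP[/eqP f0 _] /andP[/eqP g0 _].
  exact: word_adjN f0 g0.
- by rewrite size_map.
- move=> x0 i ir; rewrite (nth_map x0) //.
  by have := mem_nth x0 ir; rewrite m1 => /and3P[_ ? ?]; apply: swap_word_nadj.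
- by move: tn; rewrite -sA -sD; move: (size A) (size D) => x y; lia.
- by move: (congr1 odd sD); rewrite oddX /= (negPf et) => /negbFE.
- by move: (congr1 odd sA); rewrite oddX /= et orbT => ->.
exists c; split=> // [x y|x y w].
- by rewrite -!(perm_mem perm) cardE -(perm_size perm); apply: c2.
- by rewrite -!(perm_mem perm); apply: c3.
Qed.

End Words.

(** * Growth of powers *)

(** Bernoulli's inequality (1 + 1/t)^k >= 1 + k/t with denominators cleared. *)
Lemma expn_ratio t k : t ^ k * (t + k) <= t.+1 ^ k * t.
Proof.
elim: k => [|k IH]; first by rewrite !expn0; lia.
rewrite !expnS; have : t ^ k * (t + k) * t.+1 <= t.+1 ^ k * t * t.+1.
  by rewrite leq_mul2r IH orbT.
by nia.
Qed.

(** By Bernoulli, t (t+1)^n >= t^n (t + n), which exceeds 11 t^2 t^n. *)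
Lemma expn_dominates t n : 0 < t -> 11 * t ^ 2 < n -> 11 * t ^ n.+1 < t.+1 ^ n.
Proof.
move=> t0 tn; have := expn_ratio t n.
have p : 0 < t ^ n by rewrite expn_gt0 t0.
by rewrite expnS -(ltn_pmul2r t0); nia.
Qed.

(** * Class 1 from a finite model of the graph *)

Lemma set2_eq (T : Type) (x y x' y' : T) : [set x; y]%classic = [set x'; y']%classic ->
  (x = x' /\ y = y') \/ (x = y' /\ y = x').
Proof.
move=> e.
have [hx hy] : [set x'; y']%classic x /\ [set x'; y']%classic y.
  by rewrite -e; split; [left|right].
have [hx' hy'] : [set x; y]%classic x' /\ [set x; y]%classic y'.
  by rewrite e; split; [left|right].
case: hx hy hx' hy' => /= [->|->] [->|->] [?|?] [?|?]; subst; by [left|right].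
Qed.

Section Transfer.
Local Open Scope classical_set_scope.
Variables (T : Type) (G : sgraph T) (M : finType) (phi : M -> T).
Variables (V : pred M) (E : rel M).
Hypothesis phi_inj : injective phi.
Hypothesis phi_vertices : vertices G = phi @` [set` V].
Hypothesis phi_adj : forall a b, V a -> V b -> adj G (phi a) (phi b) <-> E a b.
Hypothesis irrE : irreflexive E.

Lemma card_neighbors_model a : V a ->
  (neighbors G (phi a) #= `I_#|[pred b | V b && E a b]|)%card.
Proof.
move=> Va; set N := [pred b | _].
have -> : neighbors G (phi a) = (phi \o (fun i : 'I_#|N| => enum_val i)) @` setT.
  apply/seteqP; split => [y ay|_ [i _ <-]]; last first.
    by have /andP[Vb Eab] := enum_valP i; apply/phi_adj.
  have [_] := adj_vertices ay; rewrite phi_vertices => -[b Vb yb].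
  have {}Vb : V b by [].
  have Nb : b \in N by rewrite inE Vb; apply/phi_adj => //; rewrite yb.
  by exists (enum_rank_in Nb b) => //=; rewrite enum_rankK_in.
have inj : injective (phi \o (fun i : 'I_#|N| => enum_val i)).
  by move=> i j /phi_inj/enum_val_inj.
rewrite (card_eql (inj_card_eq (in2W inj))) card_eq_sym; exact: card_II.
Qed.

(** The dominating vertex [a0] has the largest possible degree, one less than the number of
    vertices, and its edges need pairwise different colours; the given colouring attains this
    number. *)
Lemma class1_model (a0 : M) (c : M -> M -> nat) :
  V a0 -> (forall b, V b -> b != a0 -> E a0 b) ->
  proper_coloring E (enum V) #|V|.-1 c -> class1 G.
Proof.
move=> Va0 dom [c1 c2 c3].
have ltV a : V a -> #|[pred b | V b && E a b]| <= #|V|.-1.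
  move=> Va; rewrite (cardD1 a V) [a \in V]Va /=.
  apply: subset_leq_card; apply/fintype.subsetP => b; rewrite !inE => /andP[Vb Eab].
  by apply/andP; split=> //; apply/eqP => ba; rewrite ba irrE in Eab.
have eqV : #|[pred b | V b && E a0 b]| = #|V|.-1.
  rewrite (cardD1 a0 V) [a0 \in V]Va0 /=.
  apply: eq_card => b; rewrite !inE andbC; apply: andb_id2r => Vb.
  by case: eqVneq => [->|/(dom _ Vb)->]; rewrite ?irrE.
have edgeP e : edges G e -> exists p : M * M,
    [/\ V p.1, V p.2, E p.1 p.2 & e = [set phi p.1; phi p.2]].
  move=> [x [y [xy ->]]]; have [] := adj_vertices xy.
  rewrite phi_vertices => -[a Va ax] [b Vb yb]; subst x y.
  by exists (a, b); split => //; apply/phi_adj.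
exists #|V|.-1; split; [split|split].
- exists (phi a0); first by rewrite phi_vertices; exists a0.
  by rewrite -eqV; apply: card_neighbors_model.
- rewrite phi_vertices => _ [a Va <-].
  rewrite (card_le_eql (card_neighbors_model Va)) card_le_II; exact: ltV.
(* Each edge gets a chosen ordered pair of ends; sets that are not edges get the default (a0,
   a0). *)
- have /choice [q qP] : forall e, exists p : M * M, edges G e ->
    [/\ V p.1, V p.2, E p.1 p.2 & e = [set phi p.1; phi p.2]].
    move=> e; have [/edgeP[p pP]|ne] := pselect (edges G e); first by exists p.
    by exists (a0, a0).
  exists (fun e => c (q e).1 (q e).2); split=> [e /qP[V1 V2 E12 _]|].
    by apply: c2; rewrite ?mem_enum.
  have key a b a' b' : V a -> V b -> V a' -> V b' -> E a b -> E a' b' ->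
      a = a' -> [set phi a; phi b] <> [set phi a'; phi b'] -> c a b <> c a' b'.
    move=> Va Vb Va' Vb' Eab Eab' aa; subst a' => ne.
    by apply: c3; rewrite ?mem_enum // => bb; apply: ne; rewrite bb.
  have symE a b : V a -> V b -> E a b -> E b a.
    by move=> Va Vb /(phi_adj Va Vb)/(@adj_sym _ G) h; apply/phi_adj.
  move=> e f /qP[V1 V2 E12 eE] /qP[W1 W2 F12 fE]; move: eE fE.
  move: (q e) (q f) V1 V2 E12 W1 W2 F12 => [a b] [a' b'] /= Va Vb Eab Va' Vb' Eab'.
  (* Four cases, by which ends coincide; the symmetry of [c] moves the common end to the front. *)
  move=> -> -> ne [x /= [[->|->] [/phi_inj h|/phi_inj h]]].
  + exact: key.
  + by rewrite [c a' _]c1; apply: key => //; [apply: symE|rewrite [in RHS]setUC].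
  + by rewrite [c a _]c1; apply: key => //; [apply: symE|rewrite [in LHS]setUC].
  + rewrite [c a _]c1 [c a' _]c1; apply: key => //; try exact: symE.
    by rewrite [in LHS]setUC [in RHS]setUC.
- move=> j [d [d1 d2]]; rewrite -eqV; set N := [pred b | _].
  have Nedge (i : 'I_#|N|) : edges G [set phi a0; phi (enum_val i)].
    have /andP[Vb Eb] := enum_valP i.
    by exists (phi a0), (phi (enum_val i)); split=> //; apply/phi_adj.
  (* Colours of the edges at [a0], as an injection from its neighbours into the j colours. *)
  pose h i : 'I_j := Ordinal (d1 _ (Nedge i)).
  have hinj : injective h.
    move=> i k /(congr1 val) /= hik; apply: enum_val_inj; apply: phi_inj.
    apply: contrapT => ne; apply: (d2 _ _ (Nedge i) (Nedge k)) hik.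
      by move=> h12; have [[_ e2]|[e1 e2]] := set2_eq h12; apply: ne; rewrite e2 ?e1.
    by exists (phi a0); split; left.
  by have := leq_card h hinj; rewrite !card_ord.
Qed.

End Transfer.

Import GRing.Theory.
Local Open Scope classical_set_scope.
Local Open Scope ring_scope.

(** * Ideals and annihilators in local Artinian rings *)

Section IdealBasics.
Variable R : comPzRingType.
Implicit Types I J K M : set R.

Definition principal (x : R) : set R := [set a * x | a in setT].

Lemma is_ideal_principal x : is_ideal (principal x).
Proof.
split; first by exists 0 => //; rewrite mul0r.
- by move=> _ _ [a _ <-] [b _ <-]; exists (a + b); rewrite // mulrDl.
- by move=> a _ [b _ <-]; exists (a * b); rewrite // mulrA.
Qed.

Lemma mem_principal x : principal x x.
Proof. by exists 1; rewrite ?mul1r. Qed.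

Lemma is_ideal0 : is_ideal [set (0 : R)].
Proof.
by split=> // [x y -> ->|a x ->]; rewrite /= ?addr0 ?mulr0.
Qed.

Lemma is_idealT : is_ideal [set: R].
Proof. by []. Qed.

Lemma ideal_neq0 I : is_ideal I -> I <> [set 0] -> exists2 x, I x & x <> 0.
Proof.
move=> [I0 _ _] ne; apply: contrapT => nx; apply: ne; apply/seteqP; split.
  by move=> x Ix; apply: contrapT => x0; apply: nx; exists x.
by move=> _ ->.
Qed.

Lemma ideal_neqT I : is_ideal I -> I <> setT -> ~ I 1.
Proof.
move=> [_ _ IM] ne I1; apply: ne; apply/seteqP; split=> // x _.
by rewrite -[x]mulr1; apply: IM.
Qed.

Lemma is_ideal_Ann I : is_ideal (Ann I).
Proof.
split; first by move=> x _; rewrite mul0r.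
- by move=> r s Ar As x Ix; rewrite mulrDl Ar // As // addr0.
- by move=> a r Ar x Ix; rewrite -mulrA Ar // mulr0.
Qed.

(** The elements killed by [r] form an ideal, so killing the generating products suffices. *)
Lemma Ann_mulP I J r :
  Ann (ideal_mul I J) r <-> forall x y, I x -> J y -> r * (x * y) = 0.
Proof.
split=> [h x y Ix Jy|h s].
  by apply: h; apply: sub_gen_smallest; exists x => //; exists y.
apply: (smallest_sub (C := @is_ideal R) (X := [set s | r * s = 0])).
  split=> [|x y /= xr yr|a x /= xr]; first by rewrite /= mulr0.
    by rewrite mulrDr xr yr addr0.
  by rewrite mulrCA xr mulr0.
by move=> _ [x Ix [y Jy <-]]; apply: h.
Qed.

Lemma ideal_indexing t : (proper_ideals R #= `I_t)%card ->
  exists e : 'I_t.+1 -> set R,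
    [/\ injective e, range e = is_ideal (R := R) & e ord_max = setT].
Proof.
move=> /card_esym/card_set_bijP[f [fP finj fsurj]].
pose e (k : 'I_t.+1) := if (k < t)%N then f k else setT.
have eN (k : 'I_t.+1) : (k < t)%N -> e k <> setT.
  by rewrite /e => kt; rewrite kt; have [_] := fP _ kt.
exists e; split.
- move=> k l kl; apply: ord_inj; have hk := ltn_ord k; have hl := ltn_ord l.
  have [kt|kt] := ltnP k t; have [lt|lt] := ltnP l t.
  + by move: kl; rewrite /e kt lt; apply: finj; rewrite inE.
  + by case: (eN k kt); rewrite kl /e ltnNge lt.
  + by case: (eN l lt); rewrite -kl /e ltnNge kt.
  + by lia.
- apply/seteqP; split => [_ [k _ <-]|I iI].
    by rewrite /e; case: ifP => // kt; have [] := fP _ kt.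
  have [->|IT] := pselect (I = setT); first by exists ord_max; rewrite // /e ltnn.
  have [k kt <-] := fsurj I (conj iI IT).
  by exists (inord k) => //; rewrite /e inordK ?kt // ltnW.
- by rewrite /e ltnn.
Qed.

(** With finitely many ideals, a proper ideal above [K] that contains the most ideals is maximal. *)
Lemma proper_sub_maximal t K : (proper_ideals R #= `I_t)%card ->
  proper_ideals R K -> exists2 M, maximal_ideal M & K `<=` M.
Proof.
move=> /ideal_indexing[e [einj eran emax]] [iK KT].
have [k0 _ k0K] : range e K by rewrite eran.
pose P j := (j != ord_max) && `[< K `<=` e j >].
have P0 : P k0.
  apply/andP; split; first by apply/eqP => k0m; apply: KT; rewrite -k0K k0m.
  by apply/asboolP; rewrite k0K.
pose m j := #|[pred l | `[< e l `<=` e j >]]|.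
case: (@arg_maxnP _ k0 P m P0) => j /andP[jm /asboolP Kj] jmax.
have ij : is_ideal (e j) by have : range e (e j) by [exists j]; rewrite eran.
exists (e j) => //; split; first by split=> //; rewrite -emax => /einj/eqP; apply/negP.
move=> J [iJ JT] jJ; have [l _ lJ] : range e J by rewrite eran.
apply/seteqP; split=> //.
have Pl : P l.
  apply/andP; split; first by apply/eqP => lm; apply: JT; rewrite -lJ lm.
  by apply/asboolP; rewrite lJ; exact: subset_trans Kj jJ.
have sub : [pred i | `[< e i `<=` e j >]] \subset [pred i | `[< e i `<=` e l >]].
  apply/fintype.subsetP => i; rewrite !inE lJ => ij'.
  exact: subset_trans ij' jJ.
(* The two sets of ideals are nested and, by the choice of [j], equally large; so [J] itself lies
   below [e j]. *)
have /fintype.subsetP/(_ l) : [pred i | `[< e i `<=` e l >]] \subset [pred i | `[< e i `<=` e j >]].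
  have := jmax l Pl; rewrite /m => h.
  by rewrite -(geq_leqif (subset_leqif_card sub)).
by rewrite !inE lJ; apply.
Qed.

Lemma local_neq10 : local_ring R -> (1 : R) <> 0.
Proof.
move=> [M [[[iM MT] _] _]] e; apply: (ideal_neqT iM MT).
by rewrite e; case: iM.
Qed.

(** The element 1 - k is a unit: otherwise it and k would both lie in the unique maximal ideal, and
    so would 1. *)
Lemma local_cancel t K k x : (proper_ideals R #= `I_t)%card -> local_ring R ->
  proper_ideals R K -> K k -> x = k * x -> x = 0.
Proof.
move=> fin [M [_ uM]] pK Kk xk.
have subM J : proper_ideals R J -> J `<=` M.
  by move=> pJ; have [M' /uM -> ] := proper_sub_maximal fin pJ.
have [[iM MT] _] : maximal_ideal M.
  by have [M' hM' _] := proper_sub_maximal fin pK; rewrite (uM _ hM').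
have [prT|prT] := pselect (principal (1 - k) = setT).
  have [a _ a1] : principal (1 - k) 1 by rewrite prT.
  by rewrite -[x]mul1r -a1 -mulrA mulrBl mul1r -xk subrr mulr0.
case: (ideal_neqT iM MT); rewrite -(subrK k 1); have [_ MD _] := iM.
apply: MD; last exact: subM Kk.
exact: (subM _ (conj (is_ideal_principal _) prT) _ (mem_principal _)).
Qed.

(* Otherwise multiplying repeatedly by elements of [K] never reaches [0], and
   the resulting descending chain of principal ideals stops only if
   [x = k * x] for some [x <> 0] and [k] in [K]. *)
Lemma proper_Ann_essential t K x : (proper_ideals R #= `I_t)%card ->
  local_ring R -> artinian_ring R -> proper_ideals R K -> x <> 0 ->
  exists2 a, a * x <> 0 & Ann K (a * x).
Proof.
move=> fin loc art pK x0; apply: contrapT => nA.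
have stepP y : exists k, K k /\ (principal x y -> y <> 0 -> k * y <> 0).
  have K0 : K 0 by case: pK => -[].
  (* Only non-zero multiples of [x] matter; any other [y] gets the default k = 0. *)
  have [[a _ ay]|npy] := pselect (principal x y); last by exists 0; split=> // /npy.
  have [y0|y0] := pselect (y = 0); first by exists 0.
  apply: contrapT => nk; apply: nA; exists a; rewrite ay // => k Kk.
  apply: contrapT => yk; apply: nk; exists k; split=> // _ _.
  by rewrite mulrC.
have [s sP] := choice stepP.
pose X := fix X n := if n is n'.+1 then s (X n') * X n' else x.
have XP n : principal x (X n) /\ X n <> 0.
  elim: n => [|n [pn n0]]; first by split=> //; apply: mem_principal.
  have [_ sn] := sP (X n); split; last exact: sn.
  by have [_ _ pM] := is_ideal_principal x; apply: pM.
have [n||m mP] := art (fun n => principal (X n)).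
- exact: is_ideal_principal.
- by move=> n _ [a _ <-]; exists (a * s (X n)); rewrite //= mulrA.
(* Once the chain is stationary, X m is a multiple of X (m+1) = s (X m) * X m, hence a fixed point
   of multiplication by an element of [K]. *)
have [a _ am] : principal (X m.+1) (X m).
  by rewrite mP //; apply: mem_principal.
have [_ Xm0] := XP m; apply: Xm0.
apply: (local_cancel (k := a * s (X m)) fin loc pK); last by rewrite -mulrA.
by have [[_ _ KM] _] := pK; apply: KM; have [] := sP (X m).
Qed.
End IdealBasics.

(** * Ideals of a finite product *)

Section ProductIdeals.
Variables (I : finType) (R : I -> comPzRingType).
Implicit Types (g h : product_ring R).

Definition single i (x : R i) : product_ring R := dfwith (fun j => 0 : R j) x.

Lemma single_in i (x : R i) : single x i = x.
Proof. exact: dfwith_in. Qed.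

Lemma single_out i (x : R i) j : i != j -> single x j = 0.
Proof. exact: dfwith_out. Qed.

Lemma single_eq i (x : R i) g :
  g i = x -> (forall j, i != j -> g j = 0) -> g = single x.
Proof.
move=> gi gj; apply: functional_extensionality_dep => j.
by have [<-|ij] := eqVneq i j; rewrite ?single_in // single_out ?gj.
Qed.

Lemma mul_single i (x : R i) g : single x * g = single (x * g i).
Proof.
apply: single_eq => [|j ij]; first by rewrite /GRing.mul /= /pr_mul single_in.
by rewrite /GRing.mul /= /pr_mul single_out // mul0r.
Qed.

Lemma singleD i (x y : R i) : single (x + y) = single x + single y.
Proof.
symmetry; apply: single_eq => [|j ij]; rewrite /GRing.add /= /pr_add.
  by rewrite !single_in.
by rewrite !single_out // addr0.
Qed.

Lemma single0 i : single (0 : R i) = 0.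
Proof. by symmetry; apply: single_eq. Qed.

Lemma sum_single g : g = \sum_i single (g i).
Proof.
apply: functional_extensionality_dep => i.
have -> : (\sum_j single (g j)) i = \sum_j (single (g j) i).
  by apply: (big_morph (fun h : product_ring R => h i)).
rewrite (bigD1 i) //= single_in big1 ?addr0 // => j ji.
by rewrite single_out.
Qed.

Definition prod_ideal (J : forall i, set (R i)) : set (product_ring R) :=
  [set g | forall i, J i (g i)].

Lemma is_ideal_prod (J : forall i, set (R i)) :
  (forall i, is_ideal (J i)) -> is_ideal (prod_ideal J).
Proof.
move=> iJ; split=> [i|g h Jg Jh i|g h Jh i]; have [J0 JD JM] := iJ i.
- exact: J0.
- exact: JD.
- exact: JM.
Qed.

Lemma prod_ideal_single (J : forall i, set (R i)) i (x : R i) :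
  (forall i, is_ideal (J i)) -> prod_ideal J (single x) <-> J i x.
Proof.
move=> iJ; split=> [/(_ i)|Jx j]; first by rewrite single_in.
have [<-|ij] := eqVneq i j; rewrite ?single_in // single_out //.
by case: (iJ j).
Qed.

Definition coord_ideal (A : set (product_ring R)) i : set (R i) :=
  [set x | A (single x)].

Lemma is_ideal_coord A i : is_ideal A -> is_ideal (@coord_ideal A i).
Proof.
move=> [A0 AD AM]; split=> [|x y Ax Ay|a x Ax]; rewrite /coord_ideal /=.
- by rewrite single0.
- by rewrite singleD; apply: AD.
- by rewrite -[x](single_in (i := i)) -mul_single; apply: AM.
Qed.

(** Multiplying by the idempotents [single 1] extracts the coordinates of an element of [A], and
    every element is the finite sum of its coordinates. *)
Lemma ideal_prod_coord A : is_ideal A -> A = prod_ideal (@coord_ideal A).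
Proof.
move=> [A0 AD AM]; apply/seteqP; split=> g Ag.
  by move=> i; rewrite /coord_ideal /= -[g i]mul1r -mul_single; apply: AM.
by rewrite (sum_single g); elim/big_ind : _ => // i _; apply: Ag.
Qed.

Lemma prod_ideal_inj (J K : forall i, set (R i)) :
  (forall i, is_ideal (J i)) -> (forall i, is_ideal (K i)) ->
  prod_ideal J = prod_ideal K -> forall i, J i = K i.
Proof.
move=> iJ iK JK i; apply/seteqP; split=> x.
  by move=> /(prod_ideal_single x iJ); rewrite JK => /prod_ideal_single; apply.
by move=> /(prod_ideal_single x iK); rewrite -JK => /prod_ideal_single; apply.
Qed.

End ProductIdeals.

(** * Annihilators in a product of local Artinian rings *)

Section LocalFactors.
Variables (I : finType) (R : I -> comPzRingType) (t : nat).
Hypothesis R_local : forall i,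
  [/\ artinian_ring (R i), local_ring (R i) & (proper_ideals (R i) #= `I_t)%card].
Implicit Types J K : forall i, set (R i).

Lemma factor_neq10 i : (1 : R i) <> 0.
Proof. by have [_ loc _] := R_local i; apply: local_neq10. Qed.

Lemma factor_Ann i (A : set (R i)) x : is_ideal A -> A <> setT -> x <> 0 ->
  exists2 a, a * x <> 0 & Ann A (a * x).
Proof.
by have [art loc fin] := R_local i => iA AT; apply: (proper_Ann_essential fin).
Qed.

Lemma single_neq0 i (x : R i) : x <> 0 -> single x <> 0 :> product_ring R.
Proof.
by move=> x0 /(congr1 (fun g : product_ring R => g i)); rewrite single_in.
Qed.

(** If all factors are full the ideal contains 1; a non-zero annihilator of a proper factor, placed
    in its coordinate, kills the whole product. *)
Lemma prod_ideal_annihilated J : (forall i, is_ideal (J i)) ->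
  Ann (prod_ideal J) <> [set 0] <-> exists i, J i <> setT.
Proof.
move=> iJ; split=> [A0|[i JT] A0].
  apply: contrapT => nJ; apply: A0; apply/seteqP; split=> r; last first.
    by move=> -> g _; rewrite mul0r.
  move=> /(_ 1); rewrite mulr1; apply=> i.
  have -> : J i = setT by apply: contrapT => JT; apply: nJ; exists i.
  by [].
have [a a0 aJ] := factor_Ann (iJ i) JT (@factor_neq10 i).
have : Ann (prod_ideal J) (single (a * 1)).
  by move=> g Jg; rewrite mul_single aJ ?single0 //; apply: Jg.
by rewrite A0 => /(single_neq0 a0).
Qed.

(** If both ideals are full at i, the idempotent [single 1] at i lies in their product, so the
    annihilator meets its principal ideal in 0. Otherwise, given h in [L] with [h i] non-zero, one
    factor at i is proper and kills a non-zero multiple of [h i]. *)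
Lemma essential_Ann_mul J K (i0 : I) :
  (forall i, is_ideal (J i)) -> (forall i, is_ideal (K i)) ->
  essential (Ann (ideal_mul (prod_ideal J) (prod_ideal K))) <->
  forall i, ~ (J i = setT /\ K i = setT).
Proof.
move=> iJ iK; split=> [[_ _ ess] i [JT KT]|JK].
  have one1 : single (1 : R i) <> 0 :> product_ring R := single_neq0 (@factor_neq10 i).
  apply: (ess _ (is_ideal_principal (single (1 : R i)))).
    by move=> p0; apply: one1; have := mem_principal (single (1 : R i)); rewrite p0.
  apply/seteqP; split=> r; last first.
    move=> ->; split; first by case: (is_ideal_Ann (ideal_mul (prod_ideal J) (prod_ideal K))).
    by case: (is_ideal_principal (single (1 : R i))).
  move=> [/Ann_mulP Ar [a _ ar]].
  have pp : single (1 : R i) * single (1 : R i) = single (1 : R i).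
    by rewrite mul_single single_in mulr1.
  have := Ar (single (1 : R i)) (single (1 : R i)); rewrite pp -ar -mulrA pp; apply.
    by apply/prod_ideal_single => //; rewrite JT.
  by apply/prod_ideal_single => //; rewrite KT.
have meet (L : set (product_ring R)) : is_ideal L -> L <> [set 0] ->
    Ann (ideal_mul (prod_ideal J) (prod_ideal K)) `&` L <> [set 0].
  move=> iL /(ideal_neq0 iL)[h Lh h0] cap0.
  have [i hi] : exists i, h i <> 0.
    apply: contrapT => nh; apply: h0; apply: functional_extensionality_dep => i.
    by apply: contrapT => hi; apply: nh; exists i.
  have [a ai aJK] : exists2 a, a * h i <> 0 &
      forall x y, J i x -> K i y -> a * h i * (x * y) = 0.
    have [JT|JT] := pselect (J i = setT).
      have KT : K i <> setT by move=> KT; apply: (JK i).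
      have [a a0 aK] := factor_Ann (iK i) KT hi.
      by exists a => // x y _ Ky; rewrite mulrCA aK ?mulr0.
    have [a a0 aJ] := factor_Ann (iJ i) JT hi.
    by exists a => // x y Jx _; rewrite mulrA aJ ?mul0r.
  apply: (single_neq0 ai).
  suff : [set (0 : product_ring R)] (single (a * h i)) by [].
  rewrite -cap0; split; last by rewrite -mul_single; case: iL => _ _; apply.
  apply/Ann_mulP => x y Jx Ky; rewrite mul_single aJK ?single0 //.
split; [exact: is_ideal_Ann| |exact: meet].
(* Meeting the whole ring shows that the annihilator is non-zero; the index [i0] shows that the
   product ring is non-zero. *)
move=> A0; apply: (meet _ (is_idealT _)); last by rewrite setIT.
have : single (1 : R i0) <> 0 :> product_ring R := single_neq0 (@factor_neq10 i0).
move=> + T0; apply; suff : [set (0 : product_ring R)] (single (1 : R i0)) by [].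
by rewrite -T0.
Qed.

End LocalFactors.

(** * The graph of the product ring *)

Section ProductOfLocal.
Variables (n t : nat) (R : 'I_n.+1 -> comPzRingType).
Hypothesis R_local : forall i,
  [/\ artinian_ring (R i), local_ring (R i) & (proper_ideals (R i) #= `I_t)%card].
Local Notation word := {ffun 'I_n.+1 -> 'I_t.+1}.

(** The map [phi] identifies words with ideals, vertices with [word_vertex] and adjacency with
    [word_adj], so the colouring of words transfers. *)
Lemma class1_EG_product : (2 <= t)%N -> ~~ odd t -> (11 * t ^ n.+1 < t.+1 ^ n)%N ->
  class1 (EG (product_ring R)).
Proof.
move=> t2 et tn.
have eP i : {e : 'I_t.+1 -> set (R i) |
    [/\ injective e, range e = is_ideal (R := R i) & e ord_max = setT]}.
  by apply: cid; have [_ _] := R_local i; apply: ideal_indexing.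
pose e i := sval (eP i).
have e_inj i : injective (e i) by rewrite /e; case: (eP i) => ? [].
have e_ran i : range (e i) = is_ideal (R := R i) by rewrite /e; case: (eP i) => ? [].
have e_max i : e i ord_max = setT by rewrite /e; case: (eP i) => ? [].
have ie i k : is_ideal (e i k) by have : range (e i) (e i k) by []; rewrite e_ran.
have eT i k : e i k = setT <-> k = ord_max.
  by split=> [|-> //]; rewrite -(e_max i) => /e_inj.
pose phi (f : word) := prod_ideal (fun i => e i (f i)).
have phi_inj : injective phi.
  move=> f g fg; apply/ffunP => i; apply: (e_inj i).
  by apply: (prod_ideal_inj _ _ fg).
have iphi f : is_ideal (phi f) by apply: is_ideal_prod.
have phi_surj A : is_ideal A -> exists f, phi f = A.
  move=> iA; have /choice[k kP] : forall i, exists k, e i k = coord_ideal (i := i) A.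
    move=> i; have : range (e i) (coord_ideal (i := i) A) by rewrite e_ran; apply: is_ideal_coord.
    by move=> [k _ kA]; exists k.
  exists [ffun i => k i]; rewrite [RHS](ideal_prod_coord iA) /phi; congr prod_ideal.
  by apply: functional_extensionality_dep => i; rewrite ffunE.
have [z zP] := phi_surj _ (@is_ideal0 (product_ring R)).
have zfree i : z i != ord_max.
  apply/eqP => zi; apply: (single_neq0 (factor_neq10 R_local (i := i))).
  suff : [set (0 : product_ring R)] (single (1 : R i)) by [].
  by rewrite -zP; apply/prod_ideal_single => //; rewrite zi e_max.
have vertexE f : EG_vertices (phi f) <-> word_vertex z f.
  rewrite /EG_vertices /annihilating_ideals /word_vertex /=; split.
    move=> [[_ /(prod_ideal_annihilated R_local (fun i => ie i (f i)))[i fi]] f0].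
    apply/andP; split; first by apply/eqP => fz; apply: f0; rewrite fz zP.
    by apply/existsP; exists i; apply/eqP => /(eT i).
  move=> /andP[/eqP fz /existsP[i /eqP fi]]; split.
    split=> //; apply/(prod_ideal_annihilated R_local (fun i => ie i (f i))).
    by exists i => /eT.
  by rewrite -zP => /phi_inj.
have [c cP] := word_coloring t2 et zfree tn.
(* A dominating vertex: the constant word on letter 0 or 1, whichever differs from the first letter
   of [z]; both are proper as t >= 2. *)
have [a0 [a0V a0free]] : exists a0 : word, a0 <> z /\ forall i, a0 i != ord_max.
  pose b : 'I_t.+1 := if z ord0 == ord0 then inord 1 else ord0.
  exists [ffun=> b]; split=> [/ffunP/(_ ord0)|i]; rewrite ffunE.
    rewrite /b; case: eqP => [->|h /esym] // /(congr1 val).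
    by rewrite /= inordK //; lia.
  rewrite -val_eqE /b /=; case: ifP => _ /=; last by lia.
  by rewrite inordK; lia.
apply: (@class1_model _ _ _ phi (word_vertex z) (@word_adj n t) phi_inj _ _ _ a0 c _ _ cP).
- apply/seteqP; split=> [A VA|_ [f Vf <-]]; last by apply/vertexE.
  have [f fA] : exists f, phi f = A by apply: phi_surj; case: VA => -[].
  by exists f => //; apply/vertexE; rewrite fA.
- move=> f g Vf Vg; have essE := essential_Ann_mul R_local ord0
    (fun i => ie i (f i)) (fun i => ie i (g i)).
  rewrite /= /EG_adj; split=> [[_ _ fg /essE fgT]|/andP[/eqP fg /forallP fgT]].
    apply/andP; split; first by apply/eqP => h; apply: fg; rewrite h.
    apply/forallP => i; apply/negP => /andP[/eqP fi /eqP gi]; apply: (fgT i).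
    by rewrite fi gi e_max.
  split; [exact/vertexE|exact/vertexE|by move/phi_inj|].
  apply/essE => i [/eT fi /eT gi]; have := fgT i.
  by rewrite fi gi eqxx.
- exact: word_adj_irr.
- apply/andP; split; first exact/eqP.
  by apply/existsP; exists ord0.
- move=> b _ ba; rewrite /word_adj eq_sym ba; apply/forallP => i.
  by rewrite (negPf (a0free i)).
Qed.

End ProductOfLocal.

Theorem theorem2p6 (t : nat) (t_ge2 : (2 <= t)%N) (t_even : ~~ odd t) :
  exists2 N : nat, (2 <= N)%N &
    forall n : nat, (N <= n)%N ->
    forall R : 'I_n -> comPzRingType,
      (forall i : 'I_n,
         [/\ artinian_ring (R i), local_ring (R i)
           & (proper_ideals (R i) #= `I_t)%card]) ->
      class1 (EG (product_ring R)).
Proof.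
(* With n + 1 factors the estimate needs 11 t^2 < n, that is n + 1 >= 11 t^2 + 2. *)
exists (11 * t ^ 2 + 2)%N; first by rewrite leq_addl.
case=> [|n] Nn R R_local; first by rewrite addn2 in Nn.
apply: (class1_EG_product R_local) => //.
by apply: expn_dominates; [exact: ltnW | rewrite addn2 ltnS in Nn].
Qed.
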